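(* Let $X_t=\phi^*_1X_{t-1}+\dots+\phi^*_pX_{t-p}+Z_t$ be a causal Gaussian AR($p$) process with $p=p_n=O(\log n)$ and true coefficient vector $\phi^*\in\mathbb{R}^p$, as described in the context, belonging to the class $\mathcal{H}_\rho(l,L)$ for some fixed $\rho>1$, $0<l<1$, $L>1$. Let $s=|\{j:\phi^*_j\ne0\}|$, $\lambda_{\min}=\min_{1\le j\le p}\lambda_{n,j}$, $\lambda_{\max}=\max_{1\le j\le p}\lambda_{n,j}$. Assume there is a finite positive constant $M$ with $\lambda_{n,j}\le M$ for every $j=1,\dots,p$, and that for every $p\ge2$ there is $\kappa_p>0$ such that $\Gamma_p-\kappa_p\,\mathrm{diag}(\Gamma_p)$ is positive semi-definite. Let $F_1,F_2>0$ be constants depending only on $C_1,C_2,\beta_1,\beta_2$, and for $0<c<\infty$ and $y_0>\sigma^2(n+Dn^{3/5})$ put $$B_n(c,y_0)=6p\exp\left\{-F_1\min\left\{(\sigma^{-2}y_0-n)^{1/3},\; c^2\sigma^{-2},\; \frac{n^2\lambda_n^2\lambda_{\min}^2}{y_0+cn\lambda_n\lambda_{\max}/2}\right\}\right\}+p^2\exp\left\{-F_2\,n\lambda_n^2\,(s/p^2)\right\}.$$ Let $\lambda_n=n^{-\alpha}$ with $\alpha\in(2/5,1/2)$, and let $y_0=D_2n$ and $c=D_1y_0/(n\lambda_n\lambda_{\max})$ for positive constants $D_1,D_2$ (with $y_0>\sigma^2(n+Dn^{3/5})$). If $(s/p)^{1/2}\le Dn^{\alpha-2/5}$, then there exists an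 appropriate constant $F>0$ such that $B_n(c,y_0)$ is smaller than $$p^2\exp\Big\{-F\min\Big\{n^{1/3},\; n^{2\alpha}/\lambda_{\max}^2,\; n^{1-2\alpha}\lambda_{\min}^2,\; n^{1-2\alpha}s/p^2\Big\}\Big\},$$ which tends to zero as $n\to\infty$.
   Context: Model. For each $n$, $\{X_t\}$ satisfies $X_t=\phi^*_1X_{t-1}+\dots+\phi^*_pX_{t-p}+Z_t$, where $\{Z_t\}$ are independent Gaussian with $\mathbb{E}Z_t=0$, $\mathbb{E}Z_t^2=\sigma^2$, and $\mathrm{cov}(Z_t,X_s)=0$ for all $s<t$. The process is causal: $X_t=\sum_{j=0}^\infty\psi_jZ_{t-j}$ with $\sum_j|\psi_j|<\infty$. It is normalized so that $\mathbb{E}X_t^2=1$, i.e. $\sum_j\psi_j^2=\sigma^{-2}$. The order $p=p_n$ may grow with $n$, and $\phi^*$ and derived quantities may depend on $n$; this dependence is suppressed. Class $\mathcal{H}_\rho(l,L)$ ($\rho>1$, $0<l<1$, $L>1$): all stationary Gaussian time series with $\mathbb{E}X_t=0$, $\mathbb{E}X_t^2=1$ and $0<l\le|\psi(z)|\le L$ for every complex $z$ with $|z|\le\rho$, where $\psi(z)=\sum_{j\ge0}\psi_jz^j=1/\phi(z)$ and $\phi(z)=1-\phi^*_1z-\dots-\phi^*_pz^p$ for an AR process. Constants. $C_1=2^{10}12^2$, $C_2=2^{-3}12^{-2}$, $\beta_1=1+\frac{1}{\log\rho}$, $\beta_2=1+\frac{L\rho}{l(\rho-1)}$, $D=(C_1^3C_2\beta_1^2\beta_2^3)^{1/5}$.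 Notation. $\gamma(k)=\mathbb{E}X_tX_{t+k}$; $\Gamma_p=(\gamma(i-j))_{i,j=1}^p$; $\mathrm{diag}(\Gamma_p)$ is its diagonal part. $\lambda_n,\lambda_{n,j}\ge0$ are the deterministic tuning parameters of the Lasso estimator $\hat\phi_n$, a minimizer of $\frac{1}{2n}\sum_{t=1}^n\big(X_t-\sum_{j=1}^p\phi_jX_{t-j}\big)^2+\lambda_n\sum_{j=1}^p\lambda_{n,j}|\phi_j|$. The quantity $B_n(c,y_0)$ is the upper bound, for suitable $F_1,F_2$, on the probability $\pi_n$ that $(\hat\phi_n-\phi^* )'\Gamma_p(\hat\phi_n-\phi^* )\le C\lambda_n^2s/\kappa_p$ fails, where $C$ depends only on $M$.
   Formalization: Added, since the bound need not tend to zero otherwise (e.g. if λ_min=0 or s=0, it is p²≥1): s≥1 for all large n, and n^{1-2α}λ_min²/(1+log p)→∞. ''B_n is smaller than'' is stated for all sufficiently large n. *)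

(* Defs.v *)
From HB Require Import structures.
From mathcomp Require Import all_boot all_order all_algebra.
From mathcomp Require Import all_classical all_reals all_analysis.
From mathcomp Require Import complex.
Set Implicit Arguments.
Unset Strict Implicit.
Unset Printing Implicit Defensive.
Import Order.TTheory GRing.Theory Num.Theory.
Import numFieldNormedType.Exports.
Local Open Scope classical_set_scope.
Local Open Scope ring_scope.

Section time_series.
Context {R : realType} {d : measure_display} {T : measurableType d}.
Variable P : probability T R.

Definition mutually_independent (Z : int -> {RV P >-> R}) : Prop :=
  forall (J : seq int) (B : int -> set R), uniq J ->
    (forall t, measurable (B t)) ->
    P (\bigcap_(t in [set` J]) (Z t @^-1` B t)) =
    (\prod_(t <- J) P (Z t @^-1` B t))%E.

(* The point masses are the degenerate Gaussian laws; they are listed apart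
   because [normal_prob m 0] is not a point mass. *)
Definition gaussian_rv (Y : T -> R) : Prop :=
  (exists m s : R, 0 < s /\
     forall B, measurable B -> P (Y @^-1` B) = normal_prob m s B) \/
  (exists m : R, forall B, measurable B -> P (Y @^-1` B) = (\d_m B)%E).

Definition gaussian_series (X : int -> {RV P >-> R}) : Prop :=
  forall (m : nat) (t : 'I_m -> int) (a : 'I_m -> R),
    gaussian_rv (fun w => \sum_(i < m) a i * X (t i) w).

(* Second-order stationarity, which for Gaussian series is the same as strict
   stationarity. *)
Definition stationary (X : int -> {RV P >-> R}) : Prop :=
  forall t k : int, ('E_P[X t] = 'E_P[X 0%R])%E /\
    ('E_P[(X t \* X (t + k))%R] = 'E_P[(X 0%R \* X k)%R])%E.

(* [phi 0 j] is the coefficient of lag j + 1, and [sigma] is the standard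
   deviation (not the variance) of the noise, as in [normal_prob]. *)
Record causal_gaussian_AR (p : nat) (phi : 'rV[R]_p) (sigma : R)
    (psi : nat -> R) (X Z : int -> {RV P >-> R}) : Prop := CausalGaussianAR {
  AR_equation : forall t : int, {ae P, forall w,
    X t w = \sum_(j < p) phi 0 j * X (t - (j.+1)%:Z) w + Z t w};
  AR_sigma_gt0 : 0 < sigma;
  AR_noise_gaussian : forall (t : int) (B : set R), measurable B ->
    distribution P (Z t) B = normal_prob 0 sigma B;
  AR_noise_independent : mutually_independent Z;
  AR_noise_past : forall s t : int, s < t -> covariance P (Z t) (X s) = 0%E;
  AR_psi_summable : cvgn (series (fun j => `|psi j|));
  AR_causal : forall t : int, {ae P, forall w,
    series (fun j => psi j * Z (t - j%:Z) w) @ \oo --> X t w};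
  AR_variance1 : forall t : int, ('E_P[(X t \* X t)%R] = 1)%E;
  AR_normalized : series (fun j => psi j ^+ 2) @ \oo --> sigma ^- 2
}.

(* [v] is psi(z), the sum of the power series with coefficients [psi], and it
   equals 1 / phi(z). *)
Definition in_class_H (rho l L : R) (p : nat) (phi : 'rV[R]_p)
    (psi : nat -> R) (X : int -> {RV P >-> R}) : Prop :=
  [/\ stationary X,
      gaussian_series X,
      forall t : int, ('E_P[X t] = 0)%E,
      forall t : int, ('E_P[(X t \* X t)%R] = 1)%E &
      forall z : R[i], `|z| <= (rho%:C)%C ->
        exists v : R[i],
        [/\ (series (fun j => (psi j)%:C%C * z ^+ j : (R[i])^o) @ \oo
               --> (v : (R[i])^o)),
            v = (1 - \sum_(j < p) (phi 0 j)%:C%C * z ^+ j.+1)^-1 &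
            (l%:C)%C <= `|v| <= (L%:C)%C]].

Definition autocov (X : int -> {RV P >-> R}) (k : int) : R :=
  fine ('E_P[(X 0%R \* X k)%R])%E.

Definition Gamma (X : int -> {RV P >-> R}) (q : nat) : 'M[R]_q :=
  \matrix_(i < q, j < q) autocov X (i%:Z - j%:Z).

End time_series.

Section matrices_and_weights.
Context {R : realType}.

Definition diag_part (q : nat) (A : 'M[R]_q) : 'M[R]_q :=
  diag_mx (\row_(i < q) A i i).

Definition psd (q : nat) (A : 'M[R]_q) : Prop :=
  A^T = A /\ forall v : 'rV[R]_q, 0 <= (v *m A *m v^T) 0 0.

Definition sparsity (p : nat) (phi : 'rV[R]_p) : nat :=
  #|[set j : 'I_p | phi 0 j != 0]|.

(* The seeds 0 and [weight_max w] are neutral for nonnegative weights [w], so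
   these are the maximum and the minimum of the entries when p > 0. *)
Definition weight_max (p : nat) (w : 'rV[R]_p) : R :=
  \big[Num.max/0]_(j < p) w 0 j.
Definition weight_min (p : nat) (w : 'rV[R]_p) : R :=
  \big[Num.min/weight_max w]_(j < p) w 0 j.

End matrices_and_weights.

Section bounds.
Context {R : realType}.

Definition C1 : R := 2 ^+ 10 * 12 ^+ 2.
Definition C2 : R := 2 ^- 3 * 12 ^- 2.
Definition beta1 (rho : R) : R := 1 + 1 / ln rho.
Definition beta2 (rho l L : R) : R := 1 + L * rho / (l * (rho - 1)).
Definition Dconst (rho l L : R) : R :=
  (C1 ^+ 3 * C2 * beta1 rho ^+ 2 * beta2 rho l L ^+ 3) `^ (1 / 5).

(* [lam], [wmin], [wmax] are lambda_n, lambda_min, lambda_max. *)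
Definition Bbound (F1 F2 : R) (n p s : nat) (sigma lam wmin wmax c y0 : R) : R :=
  6 * p%:R *
    expR (- F1 * Num.min ((sigma ^- 2 * y0 - n%:R) `^ (1 / 3))
                (Num.min (c ^+ 2 * sigma ^- 2)
                         (n%:R ^+ 2 * lam ^+ 2 * wmin ^+ 2 /
                            (y0 + c * n%:R * lam * wmax / 2))))
  + p%:R ^+ 2 * expR (- F2 * (n%:R * lam ^+ 2 * (s%:R / p%:R ^+ 2))).

Definition rate_bound (F alpha : R) (n p s : nat) (wmin wmax : R) : R :=
  p%:R ^+ 2 *
    expR (- F * Num.min (n%:R `^ (1 / 3))
               (Num.min (n%:R `^ (2 * alpha) / wmax ^+ 2)
               (Num.min (n%:R `^ (1 - 2 * alpha) * wmin ^+ 2)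
                        (n%:R `^ (1 - 2 * alpha) * s%:R / p%:R ^+ 2)))).

End bounds.

(* Main.v *)
Require Import Defs.
From HB Require Import structures.
From mathcomp Require Import all_boot all_order all_algebra.
From mathcomp Require Import all_classical all_reals all_analysis.
From mathcomp Require Import lra ring.
Set Implicit Arguments.
Unset Strict Implicit.
Unset Printing Implicit Defensive.
Import Order.TTheory GRing.Theory Num.Theory.
Import numFieldNormedType.Exports.
Local Open Scope classical_set_scope.
Local Open Scope ring_scope.

(** Put m = min(n^(1/3), n^(2 alpha) / lambda_max^2, n^(1 - 2 alpha) lambda_min^2,
    n^(1 - 2 alpha) s / p^2).  Every term of the exponents of B_n is at least a
    constant times m.  For the first term this uses y_0 > sigma^2 (n + D n^(3/5)) and
    m <= n^(1 - 2 alpha) <= n^(1/5), so sigma may vary with n; for the second,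
    the same hypothesis gives sigma^2 < D_2.  Choosing F at half of the
    constants leaves a spare factor exp(- F m), which absorbs the numerical
    factor 7 because m dominates 1 + log p; the latter also makes
    p^2 exp(- F m) tend to zero. *)

(** * Elementary estimates on exponentials, powers and logarithms *)

Section elementary.
Context {R : realType}.
Implicit Types (a b e m q x A F D : R).

(** Both exponentials are at most the square of [expR (- m)], and [q <= q ^+ 2], so the left side is
    at most [7 * q ^+ 2] times that square. One factor [expR (- m)] then cancels the 7, since
    [7 < 1 + m <= expR m]. *)
Lemma two_expR_lt q a b m : 1 <= q -> 6 < m -> 2 * m <= a -> 2 * m <= b ->
  6 * q * expR (- a) + q ^+ 2 * expR (- b) < q ^+ 2 * expR (- m).
Proof.
move=> q1 m7 ma mb.
have e1 : expR (- a) <= expR (- m) * expR (- m).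
  by rewrite -expRD ler_expR; lra.
have e2 : expR (- b) <= expR (- m) * expR (- m).
  by rewrite -expRD ler_expR; lra.
have e0 : 0 < expR (- m) := expR_gt0 _.
have e7 : 7 * expR (- m) < 1.
  rewrite expRN ltr_pdivrMr ?expR_gt0// mul1r.
  by apply: lt_le_trans (expR_ge1Dx m); lra.
have q2 : q <= q ^+ 2 by nra.
have h1 : 6 * q * expR (- a) <= 6 * q ^+ 2 * (expR (- m) * expR (- m)).
  by apply: ler_pM; rewrite ?expR_ge0//; lra.
have h2 : q ^+ 2 * expR (- b) <= q ^+ 2 * (expR (- m) * expR (- m)).
  by apply: ler_wpM2l => //; lra.
have : q ^+ 2 * expR (- m) * (7 * expR (- m)) < q ^+ 2 * expR (- m) * 1.
  by rewrite ltr_pM2l// mulr_gt0//; lra.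
by lra.
Qed.

Lemma cvgn_powR_pinfty e : 0 < e -> (n%:R : R) `^ e @[n --> \oo] --> +oo.
Proof.
move=> e0; apply/cvgryPge => A.
near=> n.
have B0 : 0 <= Num.max A 0 by rewrite le_max lexx orbT.
apply: (@le_trans _ _ (Num.max A 0)); first by rewrite le_max lexx.
have -> : Num.max A 0 = (Num.max A 0 `^ e^-1) `^ e.
  by rewrite -powRrM mulVf ?lt0r_neq0// powRr1.
apply: ge0_ler_powR; rewrite ?nnegrE ?powR_ge0//; first exact: ltW.
by near: n; exact: nbhs_infty_ger.
Unshelve. all: by end_near. Qed.

(** Sublinearity of [ln] at n^(e/6) turns p = O(ln n) into p <= K n^(e/6). The cube costs only
    n^(e/2), and the other half of n^e absorbs [A]. The cube is what the sparsity term of the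
    minimum asks for: two powers from its denominator and one to dominate 1 + ln p. *)
Lemma near_polylog_le_powR (p : nat -> nat) e A : 0 < e ->
  (fun n => (p n)%:R : R^o) =O_\oo (fun n => ln n%:R : R^o) ->
  \forall n \near \oo, A * (p n)%:R ^+ 3 <= n%:R `^ e.
Proof.
move=> e0 /eqO_exP[k k0 pk].
(* The factor 6/e comes from ln n = (6/e) ln (n^(e/6)). *)
pose K := k * (6 / e).
have K0 : 0 < K by rewrite mulr_gt0// divr_gt0.
have e2 : 0 < e / 2 by rewrite divr_gt0.
have /cvgryPge/(_ (Num.max A 0 * K ^+ 3)) large := cvgn_powR_pinfty e2.
near=> n.
have n1 : 1 <= n%:R :> R by rewrite ler1n; near: n; exact: nbhs_infty_gt.
have n0 : 0 < n%:R :> R by lra.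
have pnK : (p n)%:R <= K * n%:R `^ (e / 6).
  have : `|(p n)%:R : R^o| <= k * `|ln n%:R : R^o| by near: n.
  rewrite !ger0_norm ?ln_ge0// => /le_trans; apply.
  rewrite -mulrA ler_pM2l// -ler_pdivrMl ?divr_gt0// invf_div -ln_powR.
  exact/ltW/ln_sublinear/powR_gt0.
have A0 : 0 <= Num.max A 0 by rewrite le_max lexx orbT.
apply: (@le_trans _ _ (Num.max A 0 * (p n)%:R ^+ 3)).
  by rewrite ler_wpM2r ?exprn_ge0// le_max lexx.
apply: (@le_trans _ _ (Num.max A 0 * (K * n%:R `^ (e / 6)) ^+ 3)).
  by rewrite ler_wpM2l// lerXn2r ?nnegrE// mulr_ge0 ?powR_ge0// ltW.
have -> : n%:R `^ e = n%:R `^ (e / 2) * n%:R `^ (e / 2) :> R.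
  by rewrite -powRD ?lt0r_neq0 ?implybT//; congr (_ `^ _); lra.
have -> : (K * n%:R `^ (e / 6)) ^+ 3 = K ^+ 3 * n%:R `^ (e / 2).
  by rewrite exprMn -[X in _ * X]powR_mulrn ?powR_ge0// -powRrM;
    congr (_ * _ `^ _); lra.
by rewrite mulrA ler_wpM2r ?powR_ge0//; near: n.
Unshelve. all: by end_near. Qed.

(** Since p^2 = exp(2 ln p), it suffices that F m exceeds 2 ln p by an arbitrarily large amount. The
    summand 1 in 1 + ln p secures this even where p stays bounded. *)
Lemma cvg_sqr_expR_to0 (p : nat -> nat) (m : nat -> R) F : 0 < F ->
  (forall n, (0 < n)%N -> (0 < p n)%N) ->
  (forall A, 0 < A -> \forall n \near \oo, A * (1 + ln (p n)%:R) <= m n) ->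
  (p n)%:R ^+ 2 * expR (- F * m n) @[n --> \oo] --> (0 : R).
Proof.
move=> F0 p0 mp; apply/cvgrPdist_le => eps eps0.
pose B : R := 2 + eps^-1.
have B0 : 0 < B by rewrite addr_gt0 ?invr_gt0.
near=> n.
have pn1 : 1 <= (p n)%:R :> R.
  by rewrite ler1n p0//; near: n; exact: nbhs_infty_gt.
have pn0 : 0 < (p n)%:R :> R by lra.
have lp0 : 0 <= ln (p n)%:R :> R by rewrite ln_ge0.
rewrite sub0r normrN ger0_norm ?mulr_ge0 ?expR_ge0 ?exprn_ge0//.
have -> : (p n)%:R ^+ 2 = expR (2 * ln (p n)%:R) :> R.
  by rewrite mulrC mulr_natr -lnXn// lnK// posrE exprn_gt0.
have hm : B / F * (1 + ln (p n)%:R) <= m n by near: n; apply/mp/divr_gt0.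
have {}hm : B * (1 + ln (p n)%:R) <= F * m n.
  by rewrite -ler_pdivrMl// mulrA [_^-1 * B]mulrC.
(* Taking inverses leaves 1/eps <= exp(F m - 2 ln p), which follows from 1 + x <= exp x and the
   choice of [B]. *)
rewrite -expRD -[leRHS]invrK -[leLHS]invrK lef_pV2 ?posrE ?invr_gt0 ?expR_gt0//.
rewrite -expRN; apply: le_trans (expR_ge1Dx _).
have : 0 < eps^-1 by rewrite invr_gt0.
by rewrite /B in hm; nra.
Unshelve. all: by end_near. Qed.

End elementary.

(** * Ranges of the weights and of the sparsity *)

Section weights.
Context {R : realType} (p : nat) (w : 'rV[R]_p).

Lemma weight_max_ge0 : 0 <= weight_max w.
Proof. exact: bigmax_ge_id. Qed.

Lemma weight_max_le M : 0 <= M -> (forall j, w 0 j <= M) -> weight_max w <= M.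
Proof. by move=> M0 wM; apply/bigmax_leP; split. Qed.

Lemma weight_min_ge0 : (forall j, 0 <= w 0 j) -> 0 <= weight_min w.
Proof. by move=> w0; apply/bigmin_geP; split=> //; exact: weight_max_ge0. Qed.

Lemma weight_min_le_max : weight_min w <= weight_max w.
Proof. exact: bigmin_le_id. Qed.

Lemma sparsity_le : (sparsity w <= p)%N.
Proof. by rewrite -[leqRHS]card_ord max_card. Qed.

End weights.

(** * Comparison of the two bounds at a fixed n *)

Lemma Dconst_gt0 (R : realType) (rho l L : R) :
  1 < rho -> 0 < l -> 0 < L -> 0 < Dconst rho l L.
Proof.
move=> rho1 l0 L0; apply: powR_gt0.
have b1 : 0 < beta1 rho by rewrite addr_gt0// divr_gt0// ln_gt0.
have b2 : 0 < beta2 rho l L.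
  by rewrite addr_gt0// divr_gt0 ?mulr_gt0//; lra.
by rewrite !mulr_gt0 ?exprn_gt0 ?invr_gt0.
Qed.

(** The entries of [k] are the constants lost in the three terms of the first exponent. The upper
    constraints on [F] do not involve [n], [p] or [sigma], so one [F] serves for all large n; the
    lower one, [6 < F * m], is left to the asymptotics. *)
Lemma Bbound_lt_rate_bound (R : realType) (D D1 D2 F1 F2 F alpha : R)
    (n p s : nat) (sigma wmin wmax : R) :
  let k := Num.min (D `^ (1 / 3))
             (Num.min (D1 ^+ 2 * D2) (D2 + D1 * D2 / 2)^-1) in
  let lam := n%:R `^ (- alpha) in
  let y0 := D2 * n%:R in
  let m := Num.min (n%:R `^ (1 / 3))
             (Num.min (n%:R `^ (2 * alpha) / wmax ^+ 2)
             (Num.min (n%:R `^ (1 - 2 * alpha) * wmin ^+ 2)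
                      (n%:R `^ (1 - 2 * alpha) * s%:R / p%:R ^+ 2))) in
  0 < D -> 0 < D1 -> 0 < D2 -> 0 < F1 -> 0 < F2 -> 2 / 5 < alpha ->
  2 * F <= F1 * k -> 2 * F <= F2 ->
  (0 < n)%N -> (0 < p)%N -> (s <= p)%N -> 0 < sigma -> 0 < wmax ->
  sigma ^+ 2 * (n%:R + D * n%:R `^ (3 / 5)) < y0 -> 6 < F * m ->
  Bbound F1 F2 n p s sigma lam wmin wmax (D1 * y0 / (n%:R * lam * wmax)) y0
    < rate_bound F alpha n p s wmin wmax.
Proof.
move=> k lam y0 m D0 D10 D20 F10 F20 alpha25 Fk FF2 n0 p0 sp sigma0 wmax0 hy m6.
have n1 : 1 <= n%:R :> R by rewrite ler1n.
have nR0 : 0 < n%:R :> R by lra.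
have p1 : 1 <= p%:R :> R by rewrite ler1n.
have lam0 : 0 < lam by rewrite powR_gt0.
have y00 : 0 < y0 by rewrite mulr_gt0.
have s20 : 0 < sigma ^+ 2 by rewrite exprn_gt0.
have nlam : n%:R * lam ^+ 2 = n%:R `^ (1 - 2 * alpha).
  rewrite powRD ?(lt0r_neq0 nR0) ?implybT// powRr1 ?ltW//; congr (_ * _).
  by rewrite -powR_mulrn ?powR_ge0// -powRrM; congr (_ `^ _); lra.
have lamV : (lam ^- 2 : R) = n%:R `^ (2 * alpha).
  rewrite -powR_mulrn ?powR_ge0// -powRrM -powRN; congr (_ `^ _); lra.
have m0 : 0 <= m.
  rewrite !le_min !powR_ge0/= divr_ge0 ?powR_ge0 ?sqr_ge0//= mulr_ge0 ?powR_ge0 ?sqr_ge0//=.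
have mn13 : m <= n%:R `^ (1 / 3) by rewrite ge_min lexx.
have mmax : m <= n%:R `^ (2 * alpha) / wmax ^+ 2 by rewrite !ge_min lexx !orbT.
have mmin : m <= n%:R `^ (1 - 2 * alpha) * wmin ^+ 2.
  by rewrite !ge_min lexx !orbT.
have msp : m <= n%:R `^ (1 - 2 * alpha) * s%:R / p%:R ^+ 2.
  by rewrite !ge_min lexx !orbT.
have k1 : k <= D `^ (1 / 3) by rewrite ge_min lexx.
have k2 : k <= D1 ^+ 2 * D2 by rewrite !ge_min lexx !orbT.
have k3 : k <= (D2 + D1 * D2 / 2)^-1 by rewrite !ge_min lexx !orbT.
have k0 : 0 <= k.
  rewrite !le_min powR_ge0 /= mulr_ge0 ?sqr_ge0 ?ltW//= invr_gt0.
  by rewrite addr_gt0// divr_gt0// mulr_gt0.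
(* [1 - 2 * alpha < 1 / 5], so [D n^(3/5)], the only lower bound known for
   [sigma^-2 y0 - n], is enough even though its cube root is below [n^(1/3)]. *)
have mn15 : m <= n%:R `^ (1 / 5).
  apply: le_trans msp _; rewrite -mulrA.
  apply: (@le_trans _ _ (n%:R `^ (1 - 2 * alpha))).
    rewrite ler_piMr ?powR_ge0// ler_pdivrMr ?mul1r; last by rewrite exprn_gt0; lra.
    have : s%:R <= p%:R :> R by rewrite ler_nat.
    by nra.
  by apply: ler_powR => //; lra.
have hmin : k * m <= Num.min ((sigma ^- 2 * y0 - n%:R) `^ (1 / 3))
    (Num.min ((D1 * y0 / (n%:R * lam * wmax)) ^+ 2 * sigma ^- 2)
      (n%:R ^+ 2 * lam ^+ 2 * wmin ^+ 2 /
        (y0 + D1 * y0 / (n%:R * lam * wmax) * n%:R * lam * wmax / 2))).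
  rewrite !le_min; apply/and3P; split.
  - apply: (@le_trans _ _ (D `^ (1 / 3) * n%:R `^ (1 / 5))).
      exact: ler_pM.
    have -> : n%:R `^ (1 / 5) = (n%:R `^ (3 / 5)) `^ (1 / 3) :> R.
      by rewrite -powRrM; congr (_ `^ _); lra.
    rewrite -powRM ?powR_ge0 ?(ltW D0)//.
    have h : D * n%:R `^ (3 / 5) <= sigma ^- 2 * y0 - n%:R.
      by rewrite lerBrDl ler_pdivlMl// ltW.
    have h0 : 0 <= D * n%:R `^ (3 / 5) by rewrite mulr_ge0 ?powR_ge0// ltW.
    apply: ge0_ler_powR; rewrite ?nnegrE//.
    exact: le_trans h.
  (* The factor [D2 / sigma ^+ 2] is set apart because it exceeds 1: [hy] without its n^(3/5) term
     already gives sigma^2 n < D2 n. *)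
  - have -> : (D1 * y0 / (n%:R * lam * wmax)) ^+ 2 * sigma ^- 2 =
        (D1 ^+ 2 * D2 * (D2 / sigma ^+ 2)) * (lam ^- 2 / wmax ^+ 2).
      by rewrite /y0; field; rewrite !lt0r_neq0.
    rewrite lamV; apply: ler_pM => //; apply: le_trans k2 _.
    rewrite ler_peMr ?mulr_ge0 ?sqr_ge0 ?ltW// ltr_pdivlMr// mul1r.
    have : sigma ^+ 2 * n%:R < D2 * n%:R.
      apply: le_lt_trans hy; rewrite ler_pM2l// lerDl.
      by rewrite mulr_ge0 ?powR_ge0// ltW.
    by rewrite ltr_pM2r.
  (* The choice of [c] makes c n lambda_n lambda_max equal to D1 y0, so the denominator is a
     constant times n and one power of n cancels. *)
  - have -> : n%:R ^+ 2 * lam ^+ 2 * wmin ^+ 2 /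
        (y0 + D1 * y0 / (n%:R * lam * wmax) * n%:R * lam * wmax / 2) =
        (D2 + D1 * D2 / 2)^-1 * (n%:R * lam ^+ 2 * wmin ^+ 2).
      have : 0 < 2 * D2 + D1 * D2 by rewrite addr_gt0 ?mulr_gt0.
      move=> h; rewrite /y0; field.
      by rewrite !lt0r_neq0// ?mulr_gt0//; nra.
    by rewrite nlam; exact: ler_pM.
rewrite /Bbound /rate_bound -/m !mulNr; apply: two_expR_lt => //.
- apply: (@le_trans _ _ (F1 * (k * m))); last by rewrite ler_pM2l.
  by rewrite !mulrA ler_wpM2r.
(* The second exponent is [F2] times the sparsity entry of [m] itself, so only [2 * F <= F2] is
   needed. *)
- by rewrite nlam mulrA; apply: ler_pM => //; [nra | rewrite mulrA].
Qed.

(** The probability space varies with n along with the model, as in a triangular array. The witness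
    [F] is built from [F1], [F2], [D1], [D2] and [D] alone, hence is uniform in n. *)
Theorem corollary3p4 (R : realType)
  (rho l L M F1 F2 D1 D2 alpha : R)
  (hrho : 1 < rho) (hl : 0 < l < 1) (hL : 1 < L) (hM : 0 < M)
  (hF1 : 0 < F1) (hF2 : 0 < F2) (hD1 : 0 < D1) (hD2 : 0 < D2)
  (halpha : 2 / 5 < alpha < 1 / 2)
  (d : nat -> measure_display)
  (T : forall n : nat, measurableType (d n))
  (P : forall n : nat, probability (T n) R)
  (p : nat -> nat)
  (phi : forall n : nat, 'rV[R]_(p n))
  (sigma : nat -> R)
  (psi : nat -> nat -> R)
  (X Z : forall n : nat, int -> {RV (P n) >-> R})
  (w : forall n : nat, 'rV[R]_(p n))
  (hp : forall n : nat, (0 < n)%N -> (0 < p n)%N)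
  (hplog : (fun n : nat => (p n)%:R : R^o) =O_\oo (fun n : nat => ln n%:R : R^o))
  (hAR : forall n : nat, (0 < n)%N ->
     causal_gaussian_AR (phi n) (sigma n) (psi n) (X n) (Z n))
  (hH : forall n : nat, (0 < n)%N ->
     in_class_H rho l L (phi n) (psi n) (X n))
  (hw : forall n : nat, (0 < n)%N -> forall j : 'I_(p n), 0 <= w n 0 j <= M)
  (hkappa : forall n : nat, (0 < n)%N -> forall q : nat, (2 <= q)%N ->
     exists kappa : R, 0 < kappa /\
       psd (Gamma (X n) q - kappa *: diag_part (Gamma (X n) q)))
  (* needed for the displayed bound to tend to zero *)
  (hs : \forall n \near \oo, (0 < sparsity (phi n))%N)
  (hwmin : (fun n : nat => n%:R `^ (1 - 2 * alpha) * weight_min (w n) ^+ 2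
                             / (1 + ln (p n)%:R)) @ \oo --> +oo) :
  let lam (n : nat) : R := n%:R `^ (- alpha) in
  let s (n : nat) : nat := sparsity (phi n) in
  let wmin (n : nat) : R := weight_min (w n) in
  let wmax (n : nat) : R := weight_max (w n) in
  let D : R := Dconst rho l L in
  let y0 (n : nat) : R := D2 * n%:R in
  let c (n : nat) : R := D1 * y0 n / (n%:R * lam n * wmax n) in
  (\forall n \near \oo,
     y0 n > sigma n ^+ 2 * (n%:R + D * n%:R `^ (3 / 5))) ->
  (\forall n \near \oo,
     ((s n)%:R / (p n)%:R) `^ (1 / 2) <= D * n%:R `^ (alpha - 2 / 5)) ->
  exists F : R, 0 < F /\
    (\forall n \near \oo,
       Bbound F1 F2 n (p n) (s n) (sigma n) (lam n) (wmin n) (wmax n)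
              (c n) (y0 n)
       < rate_bound F alpha n (p n) (s n) (wmin n) (wmax n)) /\
    (fun n : nat => rate_bound F alpha n (p n) (s n) (wmin n) (wmax n))
      @ \oo --> (0 : R).
Proof.
move=> lam s wmin wmax D y0 c hy0 _.
have [l0 _] := andP hl; have [a25 a12] := andP halpha.
have D0 : 0 < D by apply: Dconst_gt0 => //; lra.
pose k := Num.min (D `^ (1 / 3))
            (Num.min (D1 ^+ 2 * D2) (D2 + D1 * D2 / 2)^-1).
have k0 : 0 < k.
  rewrite !lt_min powR_gt0//= mulr_gt0 ?exprn_gt0//= invr_gt0.
  by rewrite addr_gt0// divr_gt0// mulr_gt0.
pose F := Num.min (F1 * k / 2) (F2 / 2).
have F0 : 0 < F by rewrite lt_min !divr_gt0// mulr_gt0.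
have Fk : 2 * F <= F1 * k.
  have : F <= F1 * k / 2 by rewrite ge_min lexx.
  by lra.
have FF2 : 2 * F <= F2.
  have : F <= F2 / 2 by rewrite ge_min lexx orbT.
  by lra.
(* Positivity is required because [c] divides by lambda_max. If lambda_max were 0, lambda_min would
   be 0 too, and the divergent ratio in [hwmin] would vanish. *)
have wmax_gt0 : \forall n \near \oo, 0 < wmax n.
  have /cvgryPgt/(_ 0) wpos := hwmin.
  near=> n.
  have n0 : (0 < n)%N by near: n; exact: nbhs_infty_gt.
  rewrite lt_neqAle weight_max_ge0 andbT eq_sym; apply/negP => /eqP wmax0.
  have : 0 < n%:R `^ (1 - 2 * alpha) * wmin n ^+ 2 / (1 + ln (p n)%:R).
    by near: n.
  have -> : wmin n = 0.
    apply/le_anti/andP; split; first by rewrite -wmax0 weight_min_le_max.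
    by apply: weight_min_ge0 => j; have /andP[] := hw n n0 j.
  by rewrite expr0n mulr0 mul0r ltxx.
pose m n := Num.min (n%:R `^ (1 / 3))
             (Num.min (n%:R `^ (2 * alpha) / wmax n ^+ 2)
             (Num.min (n%:R `^ (1 - 2 * alpha) * wmin n ^+ 2)
                      (n%:R `^ (1 - 2 * alpha) * (s n)%:R / (p n)%:R ^+ 2))).
(* Three entries of the minimum are powers of n up to factors bounded by [M] or by powers of p, and
   beat 1 + ln p <= p polynomially; the lambda_min entry is exactly [hwmin]. *)
have m_large A : 0 < A -> \forall n \near \oo, A * (1 + ln (p n)%:R) <= m n.
  move=> A0.
  have /cvgryPge/(_ A) wlarge := hwmin.
  have e1 : 0 < 1 / 3 :> R by lra.
  have e2 : 0 < 2 * alpha by lra.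
  have e3 : 0 < 1 - 2 * alpha by lra.
  have g1 := near_polylog_le_powR A e1 hplog.
  have g2 := near_polylog_le_powR (A * M ^+ 2) e2 hplog.
  have g3 := near_polylog_le_powR A e3 hplog.
  near=> n.
  have n0 : (0 < n)%N by near: n; exact: nbhs_infty_gt.
  have p1 : 1 <= (p n)%:R :> R by rewrite ler1n hp.
  have lp0 : 0 <= ln (p n)%:R :> R by rewrite ln_ge0.
  have lp : 1 + ln (p n)%:R <= (p n)%:R :> R.
    have := @le_ln1Dx R ((p n)%:R - 1).
    by rewrite subrKC => /(_ ltac:(lra)); lra.
  have p3 : (p n)%:R <= (p n)%:R ^+ 3 :> R by nra.
  have wmax0 : 0 < wmax n by near: n.
  have wM : wmax n <= M.
    by apply: weight_max_le => [|j]; [exact: ltW | have /andP[] := hw n n0 j].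
  rewrite !le_min; apply/and4P; split.
  - apply: (@le_trans _ _ (A * (p n)%:R ^+ 3)); last by near: n.
    by rewrite ler_pM2l//; lra.
  - rewrite ler_pdivlMr ?exprn_gt0//.
    apply: (@le_trans _ _ (A * M ^+ 2 * (p n)%:R ^+ 3)); last by near: n.
    rewrite -[leLHS]mulrA -[leRHS]mulrA ler_pM2l// mulrC.
    apply: ler_pM; rewrite ?sqr_ge0//; [|nra|lra].
    by rewrite addr_ge0.
  - by rewrite -ler_pdivlMr; [near: n | lra].
  (* Here s >= 1, from [hs], bounds the entry below by n^(1 - 2 alpha) / p^2. *)
  - rewrite ler_pdivlMr; last by rewrite exprn_gt0//; lra.
    apply: (@le_trans _ _ (n%:R `^ (1 - 2 * alpha))).
      apply: (@le_trans _ _ (A * (p n)%:R ^+ 3)); last by near: n.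
      rewrite -mulrA ler_pM2l// exprS ler_wpM2r//; exact: sqr_ge0.
    by rewrite ler_peMr ?powR_ge0// ler1n; near: n.
exists F; split=> //; split; last exact: cvg_sqr_expR_to0.
(* As ln p >= 0, the constant 7/F gives F m >= 7, above the threshold 6 of the comparison at fixed
   n. *)
have m7 : \forall n \near \oo, 7 / F * (1 + ln (p n)%:R) <= m n.
  by apply: m_large; rewrite divr_gt0.
near=> n.
have n0 : (0 < n)%N by near: n; exact: nbhs_infty_gt.
apply: (@Bbound_lt_rate_bound _ D) => //.
- exact: hp.
- exact: sparsity_le.
- exact: AR_sigma_gt0 (hAR n n0).
- by near: n.
- by near: n.
- have lp0 : 0 <= ln (p n)%:R :> R by rewrite ln_ge0// ler1n hp.
  have : 7 / F * (1 + ln (p n)%:R) <= m n by near: n.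
  rewrite -/(m n) mulrAC ler_pdivrMr// [m n * F]mulrC; lra.
Unshelve. all: by end_near. Qed.
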